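(* Let $x: M \rightarrow \mathbb{E}^{m}$ be an isometric immersion from a connected $n$-dimensional Riemannian manifold into $\mathbb{E}^m$ with parallel mean curvature vector field. Then the Laplace transformation of $x$ is a harmonic map.
   Context: Manifolds and immersions are smooth, connected and of positive dimension. $\Delta=-\operatorname{trace}\nabla^2$ is the Laplace operator of $M$. The Laplace map is $L:M\to\mathbb{E}^m$, $L(p)=(\Delta x)(p)=-nH(p)$ with $H=\frac1n\operatorname{trace}h$ the mean curvature vector; the Laplace transformation $\mathcal L:M\to L(M)$ is $L$ regarded as a map onto its image $L(M)$ (with the metric induced from $\mathbb{E}^m$). Since the tension field of $L:M\to\mathbb{E}^m$ is $-\Delta L$, $\mathcal L$ is a harmonic map iff $\Delta L$ is everywhere perpendicular to the image, i.e. $\langle (\Delta L)(p),dL(X)\rangle=0$ for all $p\in M$, $X\in T_pM$. Parallel mean curvature vector field means $DH=0$ for the normal connection $D$. *)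

(* Defs.v *)
From HB Require Import structures.
From mathcomp Require Import all_boot all_order all_algebra.
From mathcomp Require Import all_classical all_reals all_analysis.

Set Implicit Arguments.
Unset Strict Implicit.
Unset Printing Implicit Defensive.

Import Order.TTheory GRing.Theory Num.Theory.
Import numFieldNormedType.Exports.

Local Open Scope classical_set_scope.
Local Open Scope ring_scope.

(* The Euclidean space E^m is 'rV[R]_m with this inner product; its library
   norm is the sup norm, which is used only for the topology. *)
Definition dot (R : realType) (m : nat) (v w : 'rV[R]_m) : R :=
  \sum_(a < m) v 0 a * w 0 a.

Section SmoothFunctions.
Variables (R : realType) (n : nat) (W : normedModType R).

Definition partial (i : 'I_n) (f : 'rV[R]_n -> W) (u : 'rV[R]_n) : W :=
  'D_(delta_mx 0 i) f u.

(* C^oo on U, which is open in every use: all the iterated partial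
   derivatives of f are (Frechet) differentiable on U. *)
Definition smooth_on (U : set 'rV[R]_n) (f : 'rV[R]_n -> W) : Prop :=
  forall (s : seq 'I_n) (u : 'rV[R]_n), U u ->
    differentiable (foldr partial f s) u.

End SmoothFunctions.

(* The functions [chart_map] and [chart_inv] are total, but meaningful only on
   [chart_dom] and on its image respectively. *)
Record chart (R : realType) (n : nat) (M : topologicalType) := Chart {
  chart_dom : set M;
  chart_map :> M -> 'rV[R]_n;
  chart_inv : 'rV[R]_n -> M;
  chart_dom_open : open chart_dom;
  chart_cod_open : open (chart_map @` chart_dom);
  chart_mapK : forall p, chart_dom p -> chart_inv (chart_map p) = p;
  chart_map_continuous :
    forall p, chart_dom p -> {for p, continuous chart_map};
  chart_inv_continuous :
    forall u, (chart_map @` chart_dom) u -> {for u, continuous chart_inv}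
}.

Definition chart_cod (R : realType) (n : nat) (M : topologicalType)
  (c : chart R n M) : set 'rV[R]_n := c @` chart_dom c.

(* A smooth n-manifold without boundary. The atlas need not be maximal, and a
   chart of the atlas is selected around each point. *)
Record manifold (R : realType) (n : nat) := Manifold {
  manifold_space :> topologicalType;
  manifold_hausdorff : hausdorff_space manifold_space;
  manifold_second_countable : @second_countable manifold_space;
  atlas : set (chart R n manifold_space);
  chart_at : manifold_space -> chart R n manifold_space;
  chart_at_atlas : forall p, atlas (chart_at p);
  chart_at_dom : forall p, chart_dom (chart_at p) p;
  atlas_smooth : forall c d, atlas c -> atlas d ->
    smooth_on (c @` (chart_dom c `&` chart_dom d)) (d \o chart_inv c)
}.

Section Calculus.
Variables (R : realType) (n : nat) (M : manifold R n) (W : normedModType R).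

Definition smooth_map (F : M -> W) : Prop :=
  forall c, atlas c -> smooth_on (chart_cod c) (F \o chart_inv c).

(* The derivative of F along the i-th coordinate field of the chart c,
   a function of the point p in the domain of c. *)
Definition pd (c : chart R n M) (i : 'I_n) (F : M -> W) (p : M) : W :=
  partial i (F \o chart_inv c) (c p).

(* The tangent space T_p M is 'rV[R]_n: a tangent vector is given by its
   components in the chart [chart_at p]. *)
Definition differential (F : M -> W) (p : M) (X : 'rV[R]_n) : W :=
  \sum_(i < n) X 0 i *: pd (chart_at p) i F p.

End Calculus.

(* [metric c p] is the Gram matrix (g_ij) at p of the coordinate fields of c.
   Matrices act on row vectors, and row i of the Jacobian 'J is the i-th
   partial derivative. *)
Record riemannian_metric (R : realType) (n : nat) (M : manifold R n) :=
  RiemannianMetric {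
  metric :> chart R n M -> M -> 'M[R]_n;
  metric_sym : forall c p, atlas c -> chart_dom c p ->
    (metric c p)^T = metric c p;
  metric_pos : forall c p, atlas c -> chart_dom c p ->
    forall v : 'rV[R]_n, v != 0 -> 0 < (v *m metric c p *m v^T) 0 0;
  metric_smooth : forall c, atlas c -> forall i j,
    smooth_on (chart_cod c) (fun u => metric c (chart_inv c u) i j : R^o);
  metric_change : forall c d p, atlas c -> atlas d ->
    chart_dom c p -> chart_dom d p ->
    let J := 'J (d \o chart_inv c) (c p) in
    metric c p = J *m metric d p *m J^T
}.

Section RiemannianGeometry.
Variables (R : realType) (n : nat) (M : manifold R n).
Variable g : riemannian_metric M.

Definition inner (p : M) (X Y : 'rV[R]_n) : R :=
  (X *m g (chart_at p) p *m Y^T) 0 0.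

Definition metric_inv (c : chart R n M) (p : M) : 'M[R]_n := invmx (g c p).

(* Gamma^k_ij of the Levi-Civita connection of g. *)
Definition christoffel (c : chart R n M) (k i j : 'I_n) (p : M) : R :=
  2^-1 * \sum_(l < n) metric_inv c p k l *
    (pd c i (fun q => g c q j l : R^o) p
     + pd c j (fun q => g c q i l : R^o) p
     - pd c l (fun q => g c q i j : R^o) p).

Section VectorValued.
Variable W : normedModType R.

(* (nabla^2 F)(d_i, d_j). *)
Definition hessian (c : chart R n M) (F : M -> W) (i j : 'I_n) (p : M) : W :=
  pd c i (pd c j F) p - \sum_(k < n) christoffel c k i j p *: pd c k F p.

Definition laplacian (F : M -> W) (p : M) : W :=
  let c := chart_at p in
  - \sum_(i < n) \sum_(j < n) metric_inv c p i j *: hessian c F i j p.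

End VectorValued.

Section Submanifold.
Variables (m : nat) (x : M -> 'rV[R]_m).

Definition isometric_immersion : Prop :=
  [/\ smooth_map x,
      forall p, injective (differential x p) &
      forall p X Y, dot (differential x p X) (differential x p Y)
                    = inner p X Y].

(* The orthogonal projections of E^m onto dx(T_p M) and onto its orthogonal
   complement, for x an isometric immersion. *)
Definition tangent_part (p : M) (v : 'rV[R]_m) : 'rV[R]_m :=
  let c := chart_at p in
  \sum_(i < n) \sum_(j < n)
    (metric_inv c p i j * dot v (pd c i x p)) *: pd c j x p.

Definition normal_part (p : M) (v : 'rV[R]_m) : 'rV[R]_m :=
  v - tangent_part p v.

(* h(d_i, d_j) at p, for the coordinate fields of [chart_at p]. *)
Definition second_form (p : M) (i j : 'I_n) : 'rV[R]_m :=
  let c := chart_at p in normal_part p (pd c i (pd c j x) p).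

Definition mean_curvature (p : M) : 'rV[R]_m :=
  n%:R^-1 *: \sum_(i < n) \sum_(j < n)
    metric_inv (chart_at p) p i j *: second_form p i j.

(* D_X xi for the normal connection D and a normal field xi. *)
Definition normal_connection (xi : M -> 'rV[R]_m) (p : M) (X : 'rV[R]_n) :
  'rV[R]_m := normal_part p (differential xi p X).

Definition parallel_mean_curvature : Prop :=
  forall p X, normal_connection mean_curvature p X = 0.

Definition laplace_map : M -> 'rV[R]_m := laplacian x.

End Submanifold.

Definition tension (m : nat) (F : M -> 'rV[R]_m) (p : M) : 'rV[R]_m :=
  - laplacian F p.

(* F, regarded as a map onto its image with the metric induced from E^m, is
   harmonic: the tension field of F : M -> E^m has no component tangent to the
   image. The image need not be a submanifold, so its tangent space at F p is
   understood as dF(T_p M). *)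
Definition harmonic_onto_image (m : nat) (F : M -> 'rV[R]_m) : Prop :=
  forall p X, dot (tension F p) (differential F p X) = 0.

End RiemannianGeometry.

(* Main.v *)
Require Import Defs.
From HB Require Import structures.
From mathcomp Require Import all_boot all_order all_algebra.
From mathcomp Require Import all_classical all_reals all_analysis.
From mathcomp Require Import ring lra.

(* Write L = Laplacian of x = -nH and P = (g_ij)^-1. Since DH = 0 at p, every
   d_l L is tangent there, so only the tangent part of the Laplacian of L has to
   vanish. In a chart, differentiating <L, x_k> = 0 twice expresses <L_ij, x_l> by
   first derivatives of L and by <L, x_ijl>; differentiating the length
   <L, L> = - sum P_ij <L, x_ij>, which is stationary at p as L_l is tangent and L
   normal, eliminates <L, x_ijl>. What is left is the contraction of <L_i, x_j>
   with d_l P + 2 P (Christoffel symbols), which is zero because the metric is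
   parallel.
   As the chart in which L is computed may jump from point to point, one also
   needs that the Laplacian of x is the same in all charts; it is a trace of normal
   parts of the second derivatives x_ij, and the non-tensorial term in the
   transformation of x_ij is tangent. *)

Set Implicit Arguments.
Unset Strict Implicit.
Unset Printing Implicit Defensive.

Import Order.TTheory GRing.Theory Num.Theory.
Import numFieldNormedType.Exports.

Local Open Scope classical_set_scope.
Local Open Scope ring_scope.

(** * Partial derivatives on open sets and their symmetry *)

Lemma eq_differentiable (R : realType) (V W : normedModType R) (U : set V)
    (f h : V -> W) u :
  open U -> U u -> (forall z, U z -> f z = h z) ->
  differentiable f u -> differentiable h u.
Proof.
move=> oU Uu fh df.
have [cdf Ef] := (diff_locallyP _ _).1 df.
(* The first-order expansion of [f] at [u] is also one of [h], since the two agree near [u];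
   uniqueness of the differential does the rest. *)
have Eh : h \o shift u = cst (h u) + 'd f u +o_ 0 id.
  apply/eqaddoP => e e0; move/eqaddoP : Ef => /(_ e e0) Ef.
  have : \forall z \near u, U z by exact: open_nbhs_nbhs.
  rewrite (near_shift 0) subr0 => nU.
  apply: filterS2 nU Ef => z /= Uz.
  by rewrite !fctE /= (fh _ Uz) (fh u Uu).
have Ed : 'd h u = 'd f u :> (_ -> _) by exact: diff_unique.
by apply/diff_locallyP; rewrite Ed.
Qed.

Section PartialDerivatives.
Variables (R : realType) (n : nat).
Implicit Types (U : set 'rV[R]_n) (u : 'rV[R]_n) (i j : 'I_n).

Lemma eq_partial (W : normedModType R) U (f h : 'rV[R]_n -> W) i u :
  open U -> U u -> (forall z, U z -> f z = h z) -> partial i f u = partial i h u.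
Proof.
move=> oU Uu fh; apply: near_eq_derive.
by apply: filterS (open_nbhs_nbhs (conj oU Uu)) => z /fh.
Qed.

(** [foldr] applies the last index of the sequence first, so splitting off that index leaves
    iterated derivatives of [partial i f]. *)
Lemma smooth_onP (W : normedModType R) U (f : 'rV[R]_n -> W) :
  smooth_on U f <->
  (forall u, U u -> differentiable f u) /\ forall i, smooth_on U (partial i f).
Proof.
split=> [sf|[df sf] s].
  split=> [u Uu|i s u Uu]; first exact: (sf [::]).
  by have := sf (rcons s i) u Uu; rewrite foldr_rcons.
by case/lastP: s => [//|s i] u Uu; rewrite foldr_rcons; exact: sf.
Qed.

Lemma smooth_differentiable (W : normedModType R) U (f : 'rV[R]_n -> W) u :
  smooth_on U f -> U u -> differentiable f u.
Proof. by move=> /smooth_onP[df _]; exact: df. Qed.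

Lemma smooth_derivable (W : normedModType R) U (f : 'rV[R]_n -> W) u v :
  smooth_on U f -> U u -> derivable f u v.
Proof. by move=> sf Uu; exact/diff_derivable/(smooth_differentiable sf). Qed.

Lemma is_derive_partial (W : normedModType R) U (f : 'rV[R]_n -> W) u i :
  smooth_on U f -> U u -> is_derive u (delta_mx 0 i) f (partial i f u).
Proof. by move=> sf Uu; exact/derivableP/(smooth_derivable sf). Qed.

Lemma smooth_partial (W : normedModType R) U (f : 'rV[R]_n -> W) i :
  smooth_on U f -> smooth_on U (partial i f).
Proof. by move=> /smooth_onP[]. Qed.

(** Turns a directional derivative into a one-variable one, to which the mean value theorem applies;
    the difference quotients are literally the same function. *)
Lemma is_derive_line (f : 'rV[R]_n -> R) (w v : 'rV[R]_n) (s : R) :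
  derivable f (w + s *: v) v ->
  is_derive s 1 (fun t : R => f (w + t *: v) : R) ('D_v f (w + s *: v)).
Proof.
have E : (fun h : R => h^-1 *: (((fun t : R => f (w + t *: v) : R) \o shift s)
      (h *: 1) - f (w + s *: v))) =
  (fun h : R => h^-1 *: ((f \o shift (w + s *: v)) (h *: v) - f (w + s *: v))).
  apply/funext => h /=; congr (_ *: (f _ - _)).
  by rewrite [h *: 1]mulr1 scalerDl addrCA.
move=> df; apply: DeriveDef; first by rewrite /derivable E.
by rewrite /derive E.
Qed.

Lemma rectangle_MVT (f : 'rV[R]_n -> R) U u i j (h : R) :
  smooth_on U f -> 0 < h ->
  (forall s t : R, 0 <= s <= h -> 0 <= t <= h ->
    U (u + s *: delta_mx 0 i + t *: delta_mx 0 j)) ->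
  exists s t : R, [/\ 0 <= s <= h, 0 <= t <= h &
    f (u + h *: delta_mx 0 i + h *: delta_mx 0 j) - f (u + h *: delta_mx 0 i)
      - (f (u + h *: delta_mx 0 j) - f u) =
    partial j (partial i f) (u + s *: delta_mx 0 i + t *: delta_mx 0 j) * h * h].
Proof.
move=> sf h0 hU.
set ei : 'rV[R]_n := delta_mx 0 i; set ej : 'rV[R]_n := delta_mx 0 j.
have hh : 0 <= h <= h by rewrite lexx ltW.
have h00 : 0 <= (0:R) <= h by rewrite lexx ltW.
(* [F] is the increment of [f] across the square in direction j; its own increment over [0, h] is
   the second difference. The second application of the mean value theorem, to [G], is in direction
   j. *)
pose F (s : R) : R := f (u + h *: ej + s *: ei) - f (u + s *: ei).
have dF (s : R) : 0 <= s <= h -> is_derive s 1 F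
   (partial i f (u + h *: ej + s *: ei) - partial i f (u + s *: ei)).
  move=> sh; apply: is_deriveB; apply: is_derive_line.
    by rewrite addrAC; apply: (smooth_derivable sf); exact: hU.
  apply: (smooth_derivable sf).
  by have := hU s 0 sh h00; rewrite scale0r addr0.
have cF : {within `[0, h], continuous F}.
  apply: derivable_within_continuous => s; rewrite in_itv/= => sh.
  by have [] := dF _ sh.
have oc (s : R) : s \in `]0, h[%R -> 0 <= s <= h.
  by rewrite in_itv/= => /andP[s0 s1]; rewrite !ltW.
have [s /oc sh] := MVT h0 (fun s hs => dF s (oc s hs)) cF.
rewrite subr0 => EF.
pose G (t : R) : R := partial i f (u + s *: ei + t *: ej).
have dG (t : R) : 0 <= t <= h -> is_derive t 1 G
   (partial j (partial i f) (u + s *: ei + t *: ej)).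
  move=> th; apply: is_derive_line.
  by apply: (smooth_derivable (smooth_partial i sf)); exact: hU.
have cG : {within `[0, h], continuous G}.
  apply: derivable_within_continuous => t; rewrite in_itv/= => th.
  by have [] := dG _ th.
have [t /oc th] := MVT h0 (fun t ht => dG t (oc t ht)) cG.
rewrite subr0 => EG.
exists s, t; split=> //.
rewrite -EG /G scale0r addr0 [u + s *: ei + h *: ej]addrAC -EF /F !scale0r !addr0.
by rewrite [u + h *: ei + h *: ej]addrAC; lra.
Qed.

(** Schwarz's theorem. The second difference over a small square is symmetric in i and j, so both
    mixed derivatives take a common value at points near [u]; continuity concludes. *)
Lemma partialC_real (f : 'rV[R]_n -> R) U u i j :
  open U -> U u -> smooth_on U f ->
  partial i (partial j f) u = partial j (partial i f) u.
Proof.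
move=> oU Uu sf; apply/eqP; rewrite -subr_eq0 -normr_le0.
apply/ler_addgt0Pr => e e0; rewrite add0r.
have e2 : 0 < e / 2 by rewrite divr_gt0.
have nct k l : \forall z \near u,
    `|partial k (partial l f) u - partial k (partial l f) z| < e / 2.
  have ct : {for u, continuous (partial k (partial l f))}.
    apply: differentiable_continuous.
    exact: (smooth_differentiable (smooth_partial k (smooth_partial l sf))).
  by move/cvgrPdist_lt : ct; apply.
have : \forall z \near u, [/\ U z,
   `|partial i (partial j f) u - partial i (partial j f) z| < e / 2 &
   `|partial j (partial i f) u - partial j (partial i f) z| < e / 2].
  by apply: filterS3 (open_nbhs_nbhs (conj oU Uu)) (nct i j) (nct j i).
move=> /nbhs_ballP[r /= r0 Hr].
(* A displacement inside the square has norm at most h + h, so the square stays in the ball of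
   radius r. *)
have [h h0 hr] : exists2 h : R, 0 < h & h + h < r by exists (r / 3); lra.
have inB k l (s t : R) : 0 <= s <= h -> 0 <= t <= h ->
    ball u r (u + s *: delta_mx 0 k + t *: delta_mx 0 l).
  move=> /andP[s0 s1] /andP[t0 t1]; rewrite -ball_normE/=.
  rewrite -addrA opprD addNKr normrN (le_lt_trans (ler_normD _ _))// !normrZ.
  have nd k' : `|delta_mx 0 k' : 'rV[R]_n| <= 1.
    rewrite /Num.Def.normr/= mx_normrE; apply: bigmax_le => // -[a b] _.
    by rewrite mxE; case: (_ && _); rewrite ?normr1 ?normr0.
  rewrite (ger0_norm s0) (ger0_norm t0); apply: le_lt_trans hr; apply: lerD.
    exact: le_trans (ler_piMr s0 (nd k)) s1.
  exact: le_trans (ler_piMr t0 (nd l)) t1.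
have [s1 [t1 [hs1 ht1 E1]]] := @rectangle_MVT f U u i j _ sf h0
  (fun s t hs ht => let: And3 a _ _ := Hr _ (inB i j s t hs ht) in a).
have [s2 [t2 [hs2 ht2 E2]]] := @rectangle_MVT f U u j i _ sf h0
  (fun s t hs ht => let: And3 a _ _ := Hr _ (inB j i s t hs ht) in a).
have [_ _ n1] := Hr _ (inB i j _ _ hs1 ht1).
have [_ n2 _] := Hr _ (inB j i _ _ hs2 ht2).
(* Both sides, multiplied by h * h, are the same second difference. *)
have EE : partial j (partial i f) (u + s1 *: delta_mx 0 i + t1 *: delta_mx 0 j) =
          partial i (partial j f) (u + s2 *: delta_mx 0 j + t2 *: delta_mx 0 i).
  have hn0 : h != 0 by rewrite gt_eqF.
  have core (q q' a b : R) : q = a * h * h -> q' = b * h * h -> q = q' -> a = b.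
    by move=> -> -> /(mulIf hn0)/(mulIf hn0).
  apply: (core _ _ _ _ E1 E2).
  rewrite (_ : u + h *: delta_mx 0 j + h *: delta_mx 0 i =
            u + h *: delta_mx 0 i + h *: delta_mx 0 j); last exact: addrAC.
  set A := f (_ + _ + _); set B := f _; set C := f _; set D := f _.
  by move: A B C D => A B C D; ring.
rewrite -EE in n2.
rewrite distrC in n1; move: n1 n2.
set x := partial i _ u; set y := partial j _ u; set z := partial j _ _.
move=> n1 n2; rewrite -(subrKA z); apply: le_trans (ler_normD _ _) _.
rewrite [leRHS](splitr e); exact: lerD (ltW n2) (ltW n1).
Unshelve. all: by end_near. Qed.

End PartialDerivatives.

(** * Product rules for matrix-valued functions *)

Section ProductRules.
Variables (R : realType) (V : normedModType R).
Implicit Types (u v : V).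

Lemma is_derive_coord p q (F : V -> 'M[R]_(p, q)) dF u v i j :
  is_derive u v F dF -> is_derive u v (fun z => F z i j) (dF i j).
Proof.
move=> [dFu EF]; apply: DeriveDef; first exact: (derivable_mxP _ _ _).1.
by rewrite -EF derive_mx// mxE.
Qed.

Lemma is_derive_mx p q (F : V -> 'M[R]_(p, q)) (dF : 'M[R]_(p, q)) u v :
  (forall i j, is_derive u v (fun z => F z i j) (dF i j)) -> is_derive u v F dF.
Proof.
move=> dFij.
have dFu : derivable F u v by apply/derivable_mxP => i j; case: (dFij i j).
apply: DeriveDef => //; apply/matrixP => i j.
by rewrite derive_mx// mxE; case: (dFij i j).
Qed.

Lemma is_derive_bigsum (I : Type) (r : seq I) (f : I -> V -> R) df u v :
  (forall k, is_derive u v (f k) (df k)) ->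
  is_derive u v (fun z => \sum_(k <- r) f k z) (\sum_(k <- r) df k).
Proof.
move=> fk; elim: r => [|k r IH].
  rewrite big_nil (_ : (fun _ => _) = cst 0); first exact: is_derive_cst.
  by apply/funext => z; rewrite big_nil.
rewrite big_cons (_ : (fun _ => _) = f k + (fun z => \sum_(k <- r) f k z)).
  exact: is_deriveD.
by apply/funext => z; rewrite big_cons.
Qed.

Lemma is_derive_mulmx p q r (F : V -> 'M[R]_(p, q)) (G : V -> 'M[R]_(q, r))
    dF dG u v : is_derive u v F dF -> is_derive u v G dG ->
  is_derive u v (fun z => F z *m G z) (dF *m G u + F u *m dG).
Proof.
move=> hF hG; apply: is_derive_mx => i j.
rewrite (_ : (fun _ => _) = fun z => \sum_k F z i k * G z k j); last first.
  by apply/funext => z; rewrite mxE.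
rewrite 3!mxE -big_split/=; apply: is_derive_bigsum => k.
have hFk := is_derive_coord i k hF; have hGk := is_derive_coord k j hG.
apply: (@is_derive_eq _ _ _ _ _ _ _ _ (is_deriveM hFk hGk)).
by rewrite addrC; congr (_ + _); rewrite [LHS]mulrC.
Qed.

Lemma is_derive_trmx p q (F : V -> 'M[R]_(p, q)) dF u v :
  is_derive u v F dF -> is_derive u v (fun z => (F z)^T) dF^T.
Proof.
move=> hF; apply: is_derive_mx => i j; rewrite mxE.
rewrite (_ : (fun _ => _) = fun z => F z j i); first exact: is_derive_coord.
by apply/funext => z; rewrite mxE.
Qed.

Lemma dotE m (x y : 'rV[R]_m) : dot x y = (x *m y^T) 0 0.
Proof. by rewrite mxE; apply: eq_bigr => a _; rewrite mxE. Qed.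

Lemma dotC m (x y : 'rV[R]_m) : dot x y = dot y x.
Proof. by apply: eq_bigr => a _; rewrite mulrC. Qed.

Lemma is_derive_dot m (F G : V -> 'rV[R]_m) dF dG u v :
  is_derive u v F dF -> is_derive u v G dG ->
  is_derive u v (fun z => dot (F z) (G z)) (dot dF (G u) + dot (F u) dG).
Proof.
move=> hF hG; rewrite !dotE (_ : (fun _ => _) = fun z => (F z *m (G z)^T) 0 0).
  have := is_derive_coord 0 0 (is_derive_mulmx hF (is_derive_trmx hG)).
  by rewrite mxE.
by apply/funext => z; rewrite dotE.
Qed.

End ProductRules.

(** * Smoothness of algebraic expressions in smooth functions *)

Section SmoothClosure.
Variables (R : realType) (n : nat) (U : set 'rV[R]_n).
Hypothesis oU : open U.
Implicit Types (u : 'rV[R]_n) (i : 'I_n).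

Lemma eq_foldr_partial (W : normedModType R) (f h : 'rV[R]_n -> W) (s : seq 'I_n) :
  (forall u, U u -> f u = h u) ->
  forall u, U u -> foldr (@partial R n W) f s u = foldr (@partial R n W) h s u.
Proof.
by move=> fh; elim: s => //= i s IH u Uu; exact: (eq_partial i oU Uu IH).
Qed.

(** Coinduction for smoothness. Closure under partial derivatives is asked only up to equality on
    [U], because differentiation formulas are available only there. *)
Lemma smooth_coind (W : normedModType R) (P : ('rV[R]_n -> W) -> Prop) :
  (forall f, P f -> forall u, U u -> differentiable f u) ->
  (forall f i, P f -> exists2 h, P h & forall u, U u -> partial i f u = h u) ->
  forall f, P f -> smooth_on U f.
Proof.
move=> dP pP f Pf s; elim/last_ind: s f Pf => [|s i IH] f Pf u Uu; first exact: dP.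
have [h Ph fh] := pP f i Pf; rewrite foldr_rcons.
apply: (@eq_differentiable _ _ _ U (foldr (@partial R n W) h s)) => // [z Uz|].
  by apply/esym; exact: eq_foldr_partial.
exact: IH.
Qed.

Lemma smooth_coord p q (F : 'rV[R]_n -> 'M[R]_(p, q)) a b :
  smooth_on U F -> smooth_on U (fun z => F z a b).
Proof.
(* The entries at (a, b) of smooth matrix functions form a class stable under partial
   derivatives. *)
move=> sF; pose P f := exists2 G : 'rV[R]_n -> 'M[R]_(p, q),
  smooth_on U G & f = (fun z => G z a b : R).
apply: (@smooth_coind _ P); last by exists F.
- move=> _ [G sG ->] u Uu.
  apply: (@differentiable_comp _ _ _ _ G (fun M : 'M[R]_(p, q) => M a b)).
    exact: (smooth_differentiable sG).
  exact: differentiable_coord.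
- move=> _ i [G sG ->]; exists (fun z => partial i G z a b).
    by exists (partial i G) => //; exact: smooth_partial.
  move=> u Uu.
  by have [] := is_derive_coord a b (is_derive_partial i sG Uu).
Qed.

(* Unlike smoothness itself, this class is stable under partial derivatives by an
   induction on its members, so smooth_coind applies to it. *)
Inductive smooth_alg : ('rV[R]_n -> R) -> Prop :=
| smooth_alg_base f : smooth_on U f -> smooth_alg f
| smooth_alg_cst c : smooth_alg (fun=> c)
| smooth_alg_add f h :
    smooth_alg f -> smooth_alg h -> smooth_alg (fun z => f z + h z)
| smooth_alg_mul f h :
    smooth_alg f -> smooth_alg h -> smooth_alg (fun z => f z * h z)
| smooth_alg_inv f : (forall u, U u -> f u != 0) ->
    smooth_alg f -> smooth_alg (fun z => (f z)^-1).

Lemma smooth_alg_differentiable f :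
  smooth_alg f -> forall u, U u -> differentiable f u.
Proof.
elim=> {f} [f sf|c|f h _ IHf _ IHh|f h _ IHf _ IHh|f f0 _ IHf] u Uu.
- exact: (smooth_differentiable sf).
- exact: differentiable_cst.
- by apply: differentiableD; [exact: IHf|exact: IHh].
- by apply: differentiableM; [exact: IHf|exact: IHh].
- by apply: differentiableV; [exact: IHf|exact: f0].
Qed.

Lemma smooth_alg_partial f i : smooth_alg f ->
  exists2 h, smooth_alg h & forall u, U u -> partial i f u = h u.
Proof.
have dv g u : smooth_alg g -> U u -> derivable g u (delta_mx 0 i).
  by move=> ag Uu; apply: diff_derivable; exact: smooth_alg_differentiable.
elim=> {f} [f sf|c|f h af [f' af' Ef] ah [h' ah' Eh]|
  f h af [f' af' Ef] ah [h' ah' Eh]|f f0 af [f' af' Ef]].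
- by exists (partial i f) => //; apply/smooth_alg_base/smooth_partial.
- exists (fun=> 0); first exact: smooth_alg_cst.
  by move=> u Uu; exact: derive_cst.
- exists (fun z => f' z + h' z); first exact: smooth_alg_add.
  by move=> u Uu; rewrite -Ef// -Eh//; apply: deriveD; exact: dv.
- exists (fun z => f z * h' z + h z * f' z).
    by apply: smooth_alg_add; exact: smooth_alg_mul.
  by move=> u Uu; rewrite -Ef// -Eh//; apply: deriveM; exact: dv.
(* The derivative of 1/f, with its square written as a product so that it visibly lies in the
   class. *)
- exists (fun z => (-1) * ((f z)^-1 * (f z)^-1) * f' z).
    apply: smooth_alg_mul => //; apply: smooth_alg_mul; first exact: smooth_alg_cst.
    by apply: smooth_alg_mul; exact: smooth_alg_inv.
  move=> u Uu; rewrite -Ef//; apply: etrans (deriveV _ _) _; [exact: f0|exact: dv|].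
  by rewrite -exprVn expr2 mulN1r.
Qed.

Lemma smooth_algP f : smooth_alg f -> smooth_on U f.
Proof.
apply: smooth_coind; first exact: smooth_alg_differentiable.
by move=> {}f i; exact: smooth_alg_partial.
Qed.

Lemma smooth_alg_sum (I : Type) (r : seq I) (P : pred I) (f : I -> 'rV[R]_n -> R) :
  (forall k, smooth_alg (f k)) -> smooth_alg (fun z => \sum_(k <- r | P k) f k z).
Proof.
move=> af; elim: r => [|k r IH].
  by under eq_fun do rewrite big_nil; exact: smooth_alg_cst.
under eq_fun do rewrite big_cons; case: (P k) => //.
exact: smooth_alg_add.
Qed.

Lemma smooth_alg_prod (I : Type) (r : seq I) (f : I -> 'rV[R]_n -> R) :
  (forall k, smooth_alg (f k)) -> smooth_alg (fun z => \prod_(k <- r) f k z).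
Proof.
move=> af; elim: r => [|k r IH].
  by under eq_fun do rewrite big_nil; exact: smooth_alg_cst.
under eq_fun do rewrite big_cons.
exact: smooth_alg_mul.
Qed.

Lemma smooth_alg_det p (F : 'rV[R]_n -> 'M[R]_p) :
  (forall a b, smooth_alg (fun z => F z a b)) -> smooth_alg (fun z => \det (F z)).
Proof.
move=> aF; rewrite /determinant; apply: smooth_alg_sum => s.
by apply: smooth_alg_mul; [exact: smooth_alg_cst|exact: smooth_alg_prod].
Qed.

(** Cramer's rule expresses the entries through determinants. It is known only on [U], where the
    matrix is invertible, so the coinduction runs over functions that agree on [U] with a member of
    [smooth_alg]. *)
Lemma smooth_alg_invmx p (F : 'rV[R]_n -> 'M[R]_p) :
  (forall u, U u -> F u \in unitmx) ->
  (forall a b, smooth_alg (fun z => F z a b)) ->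
  forall a b, smooth_on U (fun z => invmx (F z) a b).
Proof.
move=> uF aF a b; apply: (@smooth_coind _ (fun f => exists2 h, smooth_alg h &
    forall u, U u -> f u = h u)).
- move=> f [h ah fh] u Uu.
  apply: (@eq_differentiable _ _ _ U h) => // [z Uz|]; first by rewrite fh.
  exact: smooth_alg_differentiable.
- move=> f i [h ah fh]; have [h' ah' hh'] := smooth_alg_partial i ah.
  exists h'; first by exists h'.
  by move=> u Uu; rewrite -hh'//; exact: (eq_partial i oU Uu fh).
exists (fun z => (\det (F z))^-1 * cofactor (F z) b a).
  apply: smooth_alg_mul.
    apply: smooth_alg_inv; last exact: smooth_alg_det.
    by move=> u Uu; rewrite -unitfE -unitmxE uF.
  apply: smooth_alg_mul; first exact: smooth_alg_cst.
  apply: smooth_alg_det => c d.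
  by under eq_fun do rewrite !mxE; exact: aF.
by move=> u Uu; rewrite /invmx uF// !mxE.
Qed.

Lemma partialC p q (F : 'rV[R]_n -> 'M[R]_(p, q)) i j u : U u ->
  smooth_on U F -> partial i (partial j F) u = partial j (partial i F) u.
Proof.
move=> Uu sF; apply/matrixP => a b.
have E k l : partial k (partial l F) u a b =
    partial k (partial l (fun z => F z a b)) u.
  have [_ <-] := is_derive_coord a b
    (is_derive_partial k (smooth_partial l sF) Uu).
  apply: (eq_partial k oU Uu) => z Uz.
  by have [_ <-] := is_derive_coord a b
    (is_derive_partial l sF Uz).
apply: etrans (E i j) _.
apply: etrans _ (esym (E j i)).
have sab := smooth_coord a b sF.
exact: (partialC_real i j oU Uu sab).
Qed.

End SmoothClosure.

(** * Linear algebra of Gram matrices and normal projections *)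

Section NormalProjection.
Variables (R : realType) (n m : nat).
Implicit Types (A : 'M[R]_(n, m)) (J : 'M[R]_n).

(* The matrix of the orthogonal projection onto the complement of the row space
   of A, acting on row vectors. *)
Definition normal_mx A : 'M[R]_m := 1%:M - A^T *m invmx (A *m A^T) *m A.

Lemma mul_normal_mx A : A *m A^T \in unitmx -> A *m normal_mx A = 0.
Proof.
by move=> uA; rewrite /normal_mx mulmxBr mulmx1 !mulmxA mulmxV// mul1mx subrr.
Qed.

Lemma normal_mx_mul_tr A : A *m A^T \in unitmx -> normal_mx A *m A^T = 0.
Proof.
by move=> uA; rewrite /normal_mx mulmxBl mul1mx -!mulmxA mulVmx// mulmx1 subrr.
Qed.

Lemma gram_mull J A : (J *m A) *m (J *m A)^T = J *m (A *m A^T) *m J^T.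
Proof. by rewrite trmx_mul !mulmxA. Qed.

(** The transformation law of the inverse metric. As [J] is square, invertibility of the product
    forces that of [J]. *)
Lemma invmx_congruence J (G : 'M[R]_n) : J *m G *m J^T \in unitmx ->
  J^T *m invmx (J *m G *m J^T) *m J = invmx G.
Proof.
rewrite !unitmx_mul => /andP[/andP[uJ uG] uJT].
have [Q QE] : exists Q, Q = invmx (J *m G *m J^T) by eexists.
have : J *m G *m J^T *m Q = 1%:M by rewrite QE mulmxV// !unitmx_mul uJ uG.
rewrite -QE => /(congr1 (fun M => invmx G *m (invmx J *m (M *m J)))).
by rewrite mul1mx mulVmx// mulmx1 !mulmxA mulmxKV// mulVmx// mul1mx.
Qed.

(** An invertible [J] does not change the row space of [A], hence not the projection. *)
Lemma normal_mx_mull J A : J *m (A *m A^T) *m J^T \in unitmx ->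
  normal_mx (J *m A) = normal_mx A.
Proof.
move=> uJ; rewrite /normal_mx gram_mull trmx_mul.
by rewrite -(invmx_congruence uJ) !mulmxA.
Qed.

(** Chart independence of the trace of normal parts: [J] is the Jacobian of the transition map, [y]
    and [z] are the second derivatives in the two charts. The term in [K] is a combination of rows
    of [A], killed by the projection; the rest transforms as a bilinear form. *)
Lemma normal_trace_mull J A (y z : 'I_n -> 'I_n -> 'rV[R]_m)
    (K : 'I_n -> 'I_n -> 'rV[R]_n) :
  J *m (A *m A^T) *m J^T \in unitmx ->
  (forall i j, z i j = K i j *m A +
     \sum_(a < n) \sum_(b < n) (J i a * J j b) *: y a b) ->
  \sum_(i < n) \sum_(j < n)
    invmx ((J *m A) *m (J *m A)^T) i j *: (z i j *m normal_mx (J *m A)) =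
  \sum_(a < n) \sum_(b < n) invmx (A *m A^T) a b *: (y a b *m normal_mx A).
Proof.
move=> uJ zE; have uA : A *m A^T \in unitmx.
  by move: uJ; rewrite !unitmx_mul => /andP[/andP[_ ->]].
rewrite normal_mx_mull// gram_mull -(invmx_congruence uJ).
set Q := invmx _.
have zN i j : z i j *m normal_mx A =
    \sum_(a < n) \sum_(b < n) (J i a * J j b) *: (y a b *m normal_mx A).
  rewrite zE mulmxDl -mulmxA mul_normal_mx// mulmx0 add0r mulmx_suml.
  apply: eq_bigr => a _; rewrite mulmx_suml; apply: eq_bigr => b _.
  by rewrite scalemxAl.
(* The sums over i and j are moved innermost, where they form the entries of [J^T *m Q *m J]. *)
under eq_bigr => i _ do under eq_bigr => j _ do rewrite zN scaler_sumr.
under eq_bigr => i _ do rewrite exchange_big/=.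
rewrite exchange_big/=; apply: eq_bigr => a _.
under eq_bigr => i _ do under eq_bigr => j _ do rewrite scaler_sumr.
under eq_bigr => i _ do rewrite exchange_big/=.
rewrite exchange_big/=; apply: eq_bigr => b _.
rewrite mxE scaler_suml exchange_big/=; apply: eq_bigr => j _.
rewrite mxE mulr_suml scaler_suml; apply: eq_bigr => i _.
by rewrite scalerA mxE; congr (_ *: _); rewrite mulrCA mulrA.
Qed.

(** The final cancellation: the two sums are 2 tr(P B P N^T) and its opposite. In the application B
    is <L_i, x_j>, N is <x_al, x_b>, and - P (N + N^T) P is the derivative d_l P. *)
Lemma trace_cancel (P B N : 'M[R]_n) : P^T = P -> B^T = B ->
  \sum_(i < n) \sum_(j < n)
     P i j * ((B *m P *m N^T) j i + (B *m P *m N^T) i j) +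
  \sum_(i < n) \sum_(j < n) (- (P *m (N + N^T) *m P)) i j * B i j = 0.
Proof.
move=> sP sB.
have trE (X Y : 'M[R]_n) : \sum_(i < n) \sum_(j < n) X i j * Y j i = \tr (X *m Y).
  by apply: eq_bigr => i _; rewrite mxE.
set C := B *m P *m N^T.
have -> : \sum_(i < n) \sum_(j < n) P i j * (C j i + C i j) = \tr (P *m C) *+ 2.
  under eq_bigr => i _ do under eq_bigr => j _ do rewrite mulrDr.
  under eq_bigr => i _ do rewrite big_split/=.
  rewrite big_split/= trE mulr2n; congr (_ + _).
  rewrite -trE exchange_big/=; apply: eq_bigr => i _; apply: eq_bigr => j _.
  by rewrite -{1}sP mxE.
have -> : \sum_(i < n) \sum_(j < n) (- (P *m (N + N^T) *m P)) i j * B i j =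
    - \tr (P *m C) *+ 2.
  have sBij i j : B i j = B j i by rewrite -{1}sB mxE.
  under eq_bigr => i _ do under eq_bigr => j _ do rewrite sBij.
  rewrite trE mulNmx linearN/= mulmxDr !mulmxDl linearD/= mulr2n opprD.
  congr (- _ - _).
    by rewrite -mxtrace_tr !trmx_mul sP sB /C [RHS]mxtrace_mulC !mulmxA.
  by rewrite -[X in \tr X = _]mulmxA mxtrace_mulC /C !mulmxA. 
by rewrite mulNrn subrr.
Qed.

End NormalProjection.

Lemma mul_tr_entry (R : realType) p q (y : 'rV[R]_q) (A : 'M[R]_(p, q)) l :
  (y *m A^T) 0 l = dot y (row l A).
Proof. by rewrite mxE; apply: eq_bigr => k _; rewrite !mxE. Qed.

Lemma gram_entry (R : realType) p q (A : 'M[R]_(p, q)) j l :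
  (A *m A^T) j l = dot (row j A) (row l A).
Proof. by rewrite mxE; apply: eq_bigr => k _; rewrite !mxE. Qed.

(** * Coordinate frames and the chain rule in matrix form *)

Section Frames.
Variables (R : realType) (n : nat).
Implicit Types (U : set 'rV[R]_n) (u : 'rV[R]_n).

(** The coordinate tangent vectors are the rows, so [frame X u *m (frame X u)^T] is the Gram matrix
    of the induced metric and a change of chart multiplies on the left. *)
Definition frame m (X : 'rV[R]_n -> 'rV[R]_m) u : 'M[R]_(n, m) :=
  \matrix_(i < n) partial i X u.

Lemma row_frame m (X : 'rV[R]_n -> 'rV[R]_m) u i :
  row i (frame X u) = partial i X u.
Proof. exact: rowK. Qed.

Lemma frame_jacobian m (Y : 'rV[R]_n -> 'rV[R]_m) u :
  differentiable Y u -> 'J Y u = frame Y u.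
Proof.
move=> dY; apply/row_matrixP => i.
by rewrite rowK rowE -deriveEjacobian.
Qed.

Lemma sum_partial m (Y : 'rV[R]_n -> 'rV[R]_m) u (w : 'rV[R]_n) :
  \sum_(i < n) w 0 i *: partial i Y u = w *m frame Y u.
Proof. by rewrite mulmx_sum_row; apply: eq_bigr => i _; rewrite rowK. Qed.

Lemma partial_comp m (phi : 'rV[R]_n -> 'rV[R]_n) (Y : 'rV[R]_n -> 'rV[R]_m) u i :
  differentiable phi u -> differentiable Y (phi u) ->
  partial i (Y \o phi) u = partial i phi u *m frame Y (phi u).
Proof.
move=> dphi dY; rewrite /partial deriveE; last exact: differentiable_comp.
rewrite diff_comp//= -!deriveE// -frame_jacobian// -deriveEjacobian//.
Qed.

Lemma is_derive_rows m p (Y : 'I_p -> 'rV[R]_n -> 'rV[R]_m)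
    (dY : 'I_p -> 'rV[R]_m) u v :
  (forall a, is_derive u v (Y a) (dY a)) ->
  is_derive u v (fun z => \matrix_(a < p) Y a z) (\matrix_(a < p) dY a).
Proof.
move=> hY; apply: is_derive_mx => a b; rewrite mxE.
rewrite (_ : (fun _ => _) = fun z => Y a z 0 b); first exact: is_derive_coord.
by apply/funext => z; rewrite mxE.
Qed.

Lemma is_derive_frame m U (X : 'rV[R]_n -> 'rV[R]_m) u i :
  smooth_on U X -> U u ->
  is_derive u (delta_mx 0 i) (frame X) (\matrix_a partial i (partial a X) u).
Proof.
move=> sX Uu; apply: is_derive_rows => a.
exact: (is_derive_partial i (smooth_partial a sX) Uu).
Qed.

Lemma smooth_frame m U (X : 'rV[R]_n -> 'rV[R]_m) a b :
  open U -> smooth_on U X -> smooth_on U (fun z => frame X z a b).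
Proof.
move=> oU sX; rewrite (_ : (fun _ => _) = fun z => partial a X z 0 b).
  exact: (smooth_coord oU 0 b (smooth_partial a sX)).
by apply/funext => z; rewrite mxE.
Qed.

Lemma smooth_entries_derive p q U (F : 'rV[R]_n -> 'M[R]_(p, q)) i u :
  U u -> (forall a b, smooth_on U (fun z => F z a b)) ->
  is_derive u (delta_mx 0 i) F (partial i F u).
Proof.
move=> Uu sF; apply: derivableP; apply/derivable_mxP => a b.
exact: (smooth_derivable (sF a b)).
Qed.

(** Smoothness being known entry by entry, the entries of [partial j F] are identified near [u] with
    the partial derivatives of the entries. *)
Lemma smooth_entries_derive2 p q U (F : 'rV[R]_n -> 'M[R]_(p, q)) i j u :
  open U -> U u -> (forall a b, smooth_on U (fun z => F z a b)) ->
  is_derive u (delta_mx 0 i) (partial j F) (partial i (partial j F) u).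
Proof.
move=> oU Uu sF; apply: derivableP; apply/derivable_mxP => a b.
apply: (@near_eq_derivable _ _ _ (partial j (fun z => F z a b : R))).
  have : \forall z \near u, U z by exact: open_nbhs_nbhs.
  apply: filterS => z Uz.
  by have [_ E] := is_derive_coord a b (smooth_entries_derive j Uz sF); exact: E.
exact: (smooth_derivable (smooth_partial j (sF a b))).
Qed.

End Frames.

(** * The computation inside one chart *)

Section LocalLaplacian.
Variables (R : realType) (n m : nat) (U : set 'rV[R]_n).
Variables (X : 'rV[R]_n -> 'rV[R]_m).
Hypotheses (oU : open U) (sX : smooth_on U X).
Hypothesis gram_unit : forall u, U u -> frame X u *m (frame X u)^T \in unitmx.

Let A := frame X.
Let P u := invmx (A u *m (A u)^T).

(* The mean curvature vector of X, up to the factor -n. *)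
Definition local_laplacian (u : 'rV[R]_n) : 'rV[R]_m :=
  - \sum_(i < n) \sum_(j < n)
    P u i j *: (partial i (partial j X) u *m normal_mx (A u)).

Let L := local_laplacian.

Lemma smooth_inverse_gram a b : smooth_on U (fun z => P z a b).
Proof.
apply: smooth_alg_invmx => // c d; under eq_fun do rewrite mxE.
apply: smooth_alg_sum => k; under eq_fun do rewrite [_^T _ _]mxE.
by apply: smooth_alg_mul; apply: smooth_alg_base; exact: smooth_frame.
Qed.

Lemma smooth_local_laplacian a b : smooth_on U (fun z => L z a b).
Proof.
apply: smooth_algP => //.
have aA c d : smooth_alg U (fun z => A z c d).
  by apply: smooth_alg_base; exact: smooth_frame.
have aP c d : smooth_alg U (fun z => P z c d).
  by apply: smooth_alg_base; exact: smooth_inverse_gram.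
have aN c d : smooth_alg U (fun z => normal_mx (A z) c d).
  under eq_fun do rewrite /normal_mx mxE [(- (_ *m _)) _ _]mxE -mulN1r.
  apply: smooth_alg_add; first exact: smooth_alg_cst.
  apply: smooth_alg_mul; first exact: smooth_alg_cst.
  under eq_fun do rewrite mxE; apply: smooth_alg_sum => k.
  apply: smooth_alg_mul => //.
  under eq_fun do rewrite mxE; apply: smooth_alg_sum => l.
  by apply: smooth_alg_mul => //; under eq_fun do rewrite mxE.
under eq_fun do rewrite /L /local_laplacian mxE -mulN1r summxE.
apply: smooth_alg_mul; first exact: smooth_alg_cst.
apply: smooth_alg_sum => i; under eq_fun do rewrite summxE.
apply: smooth_alg_sum => j; under eq_fun do rewrite mxE.
apply: smooth_alg_mul => //; under eq_fun do rewrite mxE.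
apply: smooth_alg_sum => k; apply: smooth_alg_mul => //.
apply: smooth_alg_base.
exact: (smooth_coord oU a k (smooth_partial i (smooth_partial j sX))).
Qed.

Lemma local_laplacian_normal u : U u -> L u *m (A u)^T = 0.
Proof.
move=> Uu; rewrite /L /local_laplacian mulNmx mulmx_suml big1 ?oppr0// => i _.
rewrite mulmx_suml big1// => j _.
by rewrite -scalemxAl -mulmxA normal_mx_mul_tr ?mulmx0 ?scaler0// gram_unit.
Qed.

Lemma local_laplacian_sqr u : U u ->
  dot (L u) (L u) =
  - \sum_(i < n) \sum_(j < n) P u i j * dot (L u) (partial i (partial j X) u).
Proof.
move=> Uu; have AL0 : A u *m (L u)^T = 0.
  by rewrite -[LHS]trmxK trmx_mul trmxK local_laplacian_normal// trmx0.
rewrite dotE {1}/L /local_laplacian mulNmx mxE mulmx_suml summxE; congr (- _).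
apply: eq_bigr => i _; rewrite mulmx_suml summxE; apply: eq_bigr => j _.
rewrite -scalemxAl mxE -mulmxA /normal_mx mulmxBl mul1mx -!mulmxA AL0 !mulmx0.
by rewrite subr0 dotC dotE.
Qed.

(* Unlike mxE, these never try to unfold the iterated partial derivatives. *)
Let tr_entry p q (M : 'M[R]_(p, q)) i j : M^T i j = M j i.
Proof. exact: mxE. Qed.
Let rows_entry p q (Y : 'I_p -> 'rV[R]_q) i j : (\matrix_a Y a) i j = Y i 0 j.
Proof. exact: mxE. Qed.
Let mul_entry p q r (M : 'M[R]_(p, q)) (N : 'M[R]_(q, r)) i j :
  (M *m N) i j = \sum_k M i k * N k j.
Proof. exact: mxE. Qed.
Let add_entry p q (M N : 'M[R]_(p, q)) i j : (M + N) i j = M i j + N i j.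
Proof. exact: mxE. Qed.
Let opp_entry p q (M : 'M[R]_(p, q)) i j : (- M) i j = - M i j.
Proof. exact: mxE. Qed.

Let scale_entry p q c (M : 'M[R]_(p, q)) i j : (c *: M) i j = c * M i j.
Proof. exact: mxE. Qed.

Let H j u : 'M[R]_(n, m) := \matrix_a partial j (partial a X) u.

Let HT_entry j u k a : (H j u)^T k a = partial j (partial a X) u 0 k.
Proof. exact: etrans (tr_entry _ _ _) (rows_entry _ _ _). Qed.

(** The device by which identities valid on all of [U] are differentiated below. *)
Lemma is_derive_eq0 (W : normedModType R) (F : 'rV[R]_n -> W) dF u v :
  U u -> (forall z, U z -> F z = 0) -> is_derive u v F dF -> dF = 0.
Proof.
move=> Uu F0 [_ <-]; rewrite -[RHS](derive_cst (0 : W) u v).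
apply: near_eq_derive.
by apply: filterS (open_nbhs_nbhs (conj oU Uu)) => z /F0.
Qed.

Lemma sym_inverse_gram u : (P u)^T = P u.
Proof. by rewrite /P trmx_inv trmx_mul trmxK. Qed.

(** Obtained by differentiating P G = 1, where G is the Gram matrix. *)
Lemma is_derive_inverse_gram l u : U u ->
  is_derive u (delta_mx 0 l) P
    (- (P u *m (H l u *m (A u)^T + (H l u *m (A u)^T)^T) *m P u)).
Proof.
move=> Uu; have hA := is_derive_frame l sX Uu.
have hG := is_derive_mulmx hA (is_derive_trmx hA).
have hP := smooth_entries_derive l Uu smooth_inverse_gram.
have hPG := is_derive_mulmx hP hG.
have h1 := is_derive_cst (1%:M : 'M[R]_n) u (delta_mx 0 l).
have hB := is_deriveB hPG h1.
have : partial l P u *m (A u *m (A u)^T) +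
       P u *m (H l u *m (A u)^T + A u *m (H l u)^T) - 0 = 0.
  apply: (is_derive_eq0 Uu _ hB) => z Uz.
  by rewrite fctE /= mulVmx ?subrr// gram_unit.
rewrite subr0 => /addr0_eq E.
have -> : - (P u *m (H l u *m (A u)^T + (H l u *m (A u)^T)^T) *m P u) =
    partial l P u.
  by rewrite trmx_mul trmxK -mulNmx -E opprK; exact: (mulmxK (gram_unit Uu)).
exact: hP.
Qed.

(** First derivative of <L, x_k> = 0; the next lemma takes the second one. *)
Lemma partial_laplacian_frame j u : U u ->
  partial j L u *m (A u)^T + L u *m (H j u)^T = 0.
Proof.
move=> Uu; have hL := smooth_entries_derive j Uu smooth_local_laplacian.
have hA := is_derive_trmx (is_derive_frame j sX Uu).
exact: (is_derive_eq0 Uu local_laplacian_normal (is_derive_mulmx hL hA)).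
Qed.

Lemma partial2_laplacian_frame i j u : U u ->
  partial i (partial j L) u *m (A u)^T + partial j L u *m (H i u)^T +
  (partial i L u *m (H j u)^T +
   L u *m (\matrix_a partial i (partial j (partial a X)) u)^T) = 0.
Proof.
move=> Uu; have hL := smooth_entries_derive i Uu smooth_local_laplacian.
have hL2 := smooth_entries_derive2 i j oU Uu smooth_local_laplacian.
have hA := is_derive_trmx (is_derive_frame i sX Uu).
have hH := is_derive_rows (fun a : 'I_n =>
  is_derive_partial i (smooth_partial j (smooth_partial a sX)) Uu).
have hD := is_deriveD (is_derive_mulmx hL2 hA)
  (is_derive_mulmx hL (is_derive_trmx hH)).
apply: (is_derive_eq0 Uu _ hD) => z Uz.
exact: (partial_laplacian_frame j Uz).
Qed.

(** Derivative of the formula for <L, L> in direction l. *)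
Lemma partial_laplacian_sqr l u : U u ->
  dot (partial l L u) (L u) + dot (L u) (partial l L u) +
  \sum_(i < n) \sum_(j < n)
    ((- (P u *m (H l u *m (A u)^T + (H l u *m (A u)^T)^T) *m P u)) i j *
      dot (L u) (partial i (partial j X) u) +
     P u i j * (dot (partial l L u) (partial i (partial j X) u) +
                dot (L u) (partial l (partial i (partial j X)) u))) = 0.
Proof.
move=> Uu; have hL := smooth_entries_derive l Uu smooth_local_laplacian.
have hP := is_derive_inverse_gram l Uu.
have hX i j := is_derive_partial l (smooth_partial i (smooth_partial j sX)) Uu.
have hPX i j := is_deriveM (is_derive_coord i j hP) (is_derive_dot hL (hX i j)).
have hS := is_derive_bigsum (index_enum 'I_n) (fun i =>
  is_derive_bigsum (index_enum 'I_n) (hPX i)).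
have := is_derive_eq0 Uu _ (is_deriveD (is_derive_dot hL hL) hS).
have E0 z : U z -> dot (L z) (L z) + \sum_(i < n) \sum_(j < n)
    P z i j * dot (L z) (partial i (partial j X) z) = 0.
  by move=> Uz; rewrite local_laplacian_sqr// addNr.
move/(_ E0) => E; apply: etrans _ E; congr (_ + _).
apply: eq_bigr => i _; apply: eq_bigr => j _.
by rewrite addrC; congr (_ + _); exact: mulrC.
Qed.

(** The hypothesis is DH = 0 at [u]. The subtracted term is the Christoffel term of the Hessian of
    L, the coefficients of the tangent part of x_ij being the Christoffel symbols. *)
Lemma local_harmonic u : U u -> frame L u *m normal_mx (A u) = 0 ->
  (\sum_(i < n) \sum_(j < n) P u i j *: (partial i (partial j L) u -
     partial i (partial j X) u *m (A u)^T *m P u *m frame L u)) *m (A u)^T = 0.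
Proof.
move=> Uu tangL.
(* B_ij = <L_i, x_j>. By tangency these inner products determine L_i, which is [LE]. *)
have [B BE] : exists B, B = frame L u *m (A u)^T by eexists.
have LE : frame L u = B *m P u *m A u.
  by rewrite BE; move/eqP: tangL; rewrite mulmxBr mulmx1 subr_eq0 !mulmxA => /eqP.
(* From <L, x_j> = 0: up to sign, B is the second fundamental form in direction L, hence
   symmetric. *)
have LB i j : dot (L u) (partial i (partial j X) u) = - B i j.
  have /(congr1 (fun M : 'rV_n => M 0 j)) := partial_laplacian_frame i Uu.
  rewrite add_entry [RHS]mxE addrC => /addr0_eq E.
  rewrite dotE.
  have -> : (L u *m (partial i (partial j X) u)^T) 0 0 = (L u *m (H i u)^T) 0 j.
    rewrite !mul_entry; apply: eq_bigr => k _.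
    by congr (_ * _); rewrite [LHS]tr_entry [RHS]HT_entry.
  rewrite -[LHS]opprK E; congr (- _); rewrite BE !mul_entry; apply: eq_bigr => k _.
  by congr (_ * _); exact/esym/mxE.
have sB : B^T = B.
  apply/matrixP => i j; rewrite mxE; apply: oppr_inj; rewrite -!LB.
  by rewrite (partialC oU j i Uu sX).
apply/rowP => l; rewrite [RHS]mxE.
(* By [LE], the entry C_ji is <L_j, x_il>. *)
pose N := H l u *m (A u)^T; pose C := B *m P u *m N^T.
have CE i j : (partial j L u *m (H i u)^T) 0 l = C j i.
  rewrite /C /N trmx_mul trmxK mulmxA -LE !mul_entry; apply: eq_bigr => k _.
  congr (_ * _); first exact/esym/mxE.
  by rewrite [LHS]HT_entry [RHS]HT_entry (partialC oU i l Uu sX).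
have tE i j : (L u *m (\matrix_a partial i (partial j (partial a X)) u)^T) 0 l =
    dot (L u) (partial l (partial i (partial j X)) u).
  have E3 : partial i (partial j (partial l X)) u =
            partial l (partial i (partial j X)) u.
    apply: etrans (partialC oU i l Uu (smooth_partial j sX)).
    by apply: (eq_partial i oU Uu) => z Uz; exact: (partialC oU j l Uz sX).
  rewrite -E3 mul_entry; apply: eq_bigr => k _; congr (_ * _).
  exact: etrans (tr_entry _ _ _) (rows_entry _ _ _).
(* The Christoffel term paired with x_l: symmetry of B and tangency of L_l turn it into <L_l,
   x_ij>. *)
have gE i j :
    (partial i (partial j X) u *m (A u)^T *m P u *m frame L u *m (A u)^T) 0 l =
    dot (partial l L u) (partial i (partial j X) u).
  have -> : partial l L u = row l (frame L u) by rewrite rowK.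
  set y := partial i _ u.
  rewrite -(mulmxA _ (frame L u)) -BE dotE LE -row_mul.
  have -> : row l (B *m P u *m A u *m y^T) = (col l (y *m (A u)^T *m P u *m B))^T.
    by rewrite tr_col !trmx_mul !trmxK sym_inverse_gram sB !mulmxA.
  by rewrite tr_entry [RHS]mxE.
have sum4 (a b c d : 'rV[R]_n) : a + b + (c + d) = 0 ->
    a 0 l = - b 0 l - c 0 l - d 0 l.
  move=> /(congr1 (fun M : 'rV_n => M 0 l)).
  by rewrite !add_entry [RHS]mxE => E; lra.
(* The last bracket is exactly the one in [partial_laplacian_sqr], third derivatives included. *)
have termE i j : (P u i j *: (partial i (partial j L) u -
     partial i (partial j X) u *m (A u)^T *m P u *m frame L u) *m (A u)^T) 0 l =
  - (P u i j * (C j i + C i j)) - P u i j *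
   (dot (partial l L u) (partial i (partial j X) u) +
    dot (L u) (partial l (partial i (partial j X)) u)).
  rewrite -scalemxAl scale_entry -mulrN -mulrBr; congr (_ * _).
  rewrite mulmxBl add_entry opp_entry gE.
  have key (x y z w x' y' z' c : R) : w = - x - y - z ->
      x = x' -> y = y' -> z = z' -> w - c = - (x' + y') - (c + z').
    by move=> -> -> -> ->; ring.
  exact: (key _ _ _ _ _ _ _ _ (sum4 _ _ _ _ (partial2_laplacian_frame i j Uu))
    (CE i j) (CE j i) (tE i j)).
(* L_l is tangent and L is normal, so the length of L is stationary at [u]. *)
have LL0 : dot (L u) (partial l L u) = 0.
  have -> : partial l L u = row l (frame L u) by rewrite rowK.
  rewrite LE row_mul dotC dotE -mulmxA.
  have -> : A u *m (L u)^T = 0.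
    by rewrite -[LHS]trmxK trmx_mul trmxK local_laplacian_normal// trmx0.
  by rewrite mulmx0 mxE.
have := partial_laplacian_sqr l Uu; rewrite -/N dotC LL0 !add0r => sqrE.
have := trace_cancel N (sym_inverse_gram u) sB; rewrite -/C => trE.
rewrite mulmx_suml summxE.
under eq_bigr => i _ do rewrite mulmx_suml summxE.
under eq_bigr => i _ do under eq_bigr => j _ do rewrite termE.
under eq_bigr => i _ do rewrite big_split/= !sumrN.
rewrite big_split/= !sumrN -opprD; apply/eqP; rewrite oppr_eq0; apply/eqP.
apply: etrans trE; congr (_ + _).
(* [sqrE] trades the bracket with third derivatives for d_l P contracted with <L, x_ij> = - B_ij,
   leaving the sum of [trace_cancel]. *)
move: sqrE; under eq_bigr => i _ do rewrite big_split/=.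
rewrite big_split/= => /addr0_eq <-; rewrite -sumrN.
apply: eq_bigr => i _; rewrite -sumrN; apply: eq_bigr => j _.
by rewrite LB mulrN opprK.
Qed.

End LocalLaplacian.

(** * Charts and coordinate derivatives on the manifold *)

Section Charts.
Variables (R : realType) (n : nat) (M : manifold R n).
Implicit Types (c d : chart R n M) (p q : M) (i j : 'I_n).

Lemma chart_cod_map c q : chart_dom c q -> chart_cod c (c q).
Proof. by move=> cq; exists q. Qed.

Lemma chart_inv_dom c u : chart_cod c u -> chart_dom c (chart_inv c u).
Proof. by move=> [q cq <-]; rewrite chart_mapK. Qed.

Lemma chart_invK c u : chart_cod c u -> c (chart_inv c u) = u.
Proof. by move=> [q cq <-]; rewrite chart_mapK. Qed.

(** Within the open image of c, this set is the preimage of the domain of d under the continuous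
    inverse of c. *)
Lemma open_chart_overlap c d : open (c @` (chart_dom c `&` chart_dom d)).
Proof.
rewrite openE => u [q [cq dq] uE].
have cu : chart_cod c u by exists q.
have du : chart_dom d (chart_inv c u) by rewrite -uE chart_mapK.
have nd : \forall z \near u, chart_dom d (chart_inv c z).
  have nd : nbhs (chart_inv c u) (chart_dom d).
    by apply: open_nbhs_nbhs; split=> //; exact: chart_dom_open.
  exact: (chart_inv_continuous cu) nd.
have nc : \forall z \near u, chart_cod c z.
  by apply: open_nbhs_nbhs; split=> //; exact: chart_cod_open.
apply: filterS2 nd nc => z dz cz.
exists (chart_inv c z); last exact: chart_invK.
by split => //; exact: chart_inv_dom.
Qed.

Lemma pd_pd (W : normedModType R) c (F : M -> W) i j q : chart_dom c q ->
  pd c i (pd c j F) q = partial i (partial j (F \o chart_inv c)) (c q).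
Proof.
move=> cq; rewrite {1}/pd.
apply: (eq_partial i (@chart_cod_open _ _ _ c) (chart_cod_map cq)) => u cu.
by rewrite /= /pd (chart_invK cu).
Qed.

Lemma metric_unit (g : riemannian_metric M) c q :
  atlas c -> chart_dom c q -> g c q \in unitmx.
Proof.
move=> ac cq; rewrite unitmxE unitfE; apply/negP => /det0P[v v0 vg].
by have := metric_pos g ac cq v0; rewrite vg mul0mx mxE ltxx.
Qed.

End Charts.

(** * Geometry of the immersion in charts *)

Section IsometricImmersion.
Variables (R : realType) (n m : nat) (M : manifold R n).
Variables (g : riemannian_metric M) (x : M -> 'rV[R]_m).
Hypothesis x_isometric : isometric_immersion g x.
Implicit Types (c d : chart R n M) (p q : M) (i j : 'I_n).

Local Notation lx c := (x \o chart_inv c).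
Local Notation fr c q := (frame (lx c) (c q)).

Let sx c : atlas c -> smooth_on (chart_cod c) (lx c).
Proof. by case: x_isometric => s _ _; exact: s. Qed.

Lemma differentialE (F : M -> 'rV[R]_m) p (X : 'rV[R]_n) :
  differential F p X = X *m frame (F \o chart_inv (chart_at p)) (chart_at p p).
Proof. exact: sum_partial. Qed.

(** The isometry condition, tested on basis vectors; it refers to the selected chart only. *)
Lemma gram_chart_at p :
  fr (chart_at p) p *m (fr (chart_at p) p)^T = g (chart_at p) p.
Proof.
case: x_isometric => _ _ iso; apply/matrixP => i j.
have := iso p (delta_mx 0 i) (delta_mx 0 j).
rewrite !differentialE dotE /inner; set A := frame _ _; set G := metric _ _ _.
by rewrite trmx_mul mulmxA -(mulmxA (delta_mx 0 i)) -!rowE !trmx_delta -!colE !mxE.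
Qed.

(** * Comparison of an arbitrary chart with the selected one *)

Section Overlap.
Variables (c : chart R n M) (q : M).
Hypotheses (ac : atlas c) (cq : chart_dom c q).
Let d := chart_at q.
Let phi : 'rV[R]_n -> 'rV[R]_n := d \o chart_inv c.
Let V := c @` (chart_dom c `&` chart_dom d).

Let oV : open V. Proof. exact: open_chart_overlap. Qed.
Let Vq : V (c q).
Proof. by exists q => //; split=> //; exact: chart_at_dom. Qed.
Let sphi : smooth_on V phi.
Proof. by apply: atlas_smooth => //; exact: chart_at_atlas. Qed.
Let phiq : phi (c q) = d q. Proof. by rewrite /phi /= chart_mapK. Qed.
Let phi_cod z : V z -> chart_cod d (phi z).
Proof.
by move=> [r [cr dr] <-]; rewrite /phi /= chart_mapK//; exact: chart_cod_map.
Qed.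
Let sxd : smooth_on (chart_cod d) (lx d).
Proof. by apply: sx; exact: chart_at_atlas. Qed.

Let lxE z : V z -> lx c z = (lx d \o phi) z.
Proof. by move=> [r [cr dr] <-] /=; rewrite /phi /= !chart_mapK. Qed.

Lemma partial_overlap j z : V z ->
  partial j (lx c) z = partial j phi z *m frame (lx d) (phi z).
Proof.
move=> Vz; rewrite (eq_partial j oV Vz lxE) partial_comp//.
  exact: (smooth_differentiable sphi).
exact: (smooth_differentiable sxd (phi_cod Vz)).
Qed.

Lemma frame_overlap : fr c q = frame phi (c q) *m fr d q.
Proof.
apply/row_matrixP => i.
apply: etrans (row_frame _ _ _) (etrans (partial_overlap i Vq) _).
by rewrite phiq row_mul; congr (_ *m _); exact/esym/row_frame.
Qed.

(** Both sides obey the same transformation law under the transition map, so the equality passes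
    from the selected chart to every chart of the atlas. *)
Lemma metric_gram : fr c q *m (fr c q)^T = g c q.
Proof.
rewrite frame_overlap gram_mull gram_chart_at -frame_jacobian; last first.
  exact: (smooth_differentiable sphi).
rewrite [RHS](metric_change g (d := d))//; first exact: chart_at_atlas.
exact: chart_at_dom.
Qed.

(** The second-order chain rule; its first summand is the non-tensorial, tangent one, which plays
    the part of [K] in [normal_trace_mull]. *)
Lemma partial2_overlap i j :
  partial i (partial j (lx c)) (c q) =
  partial i (partial j phi) (c q) *m fr d q +
  \sum_(a < n) \sum_(b < n) (frame phi (c q) i a * frame phi (c q) j b) *:
    partial a (partial b (lx d)) (d q).
Proof.
have hF : is_derive (c q) (delta_mx 0 i) (fun z => frame (lx d) (phi z))
    (\matrix_b (partial i phi (c q) *m frame (partial b (lx d)) (d q))).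
  apply: is_derive_rows => b.
  have dphi := smooth_differentiable sphi Vq.
  have dX := smooth_differentiable (smooth_partial b sxd) (phi_cod Vq).
  apply: DeriveDef; last by rewrite -phiq; exact: partial_comp.
  by apply/diff_derivable; exact: differentiable_comp dX.
have hP := is_derive_partial i (smooth_partial j sphi) Vq.
rewrite (eq_partial i oV Vq (partial_overlap j)).
have [_ E] := is_derive_mulmx hP hF; apply: etrans E _.
rewrite phiq; congr (_ + _).
rewrite mulmx_sum_row exchange_big/=; apply: eq_bigr => b _.
rewrite rowK -sum_partial scaler_sumr; apply: eq_bigr => a _.
by rewrite scalerA mulrC; congr (_ * _ *: _); exact/esym/mxE.
Qed.

Lemma local_laplacian_overlap :
  local_laplacian (lx c) (c q) = local_laplacian (lx d) (d q).
Proof.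
rewrite /local_laplacian frame_overlap; congr (- _).
apply: normal_trace_mull partial2_overlap.
by rewrite -gram_mull -frame_overlap metric_gram metric_unit.
Qed.

End Overlap.

Lemma gram_unit_chart c u : atlas c -> chart_cod c u ->
  frame (lx c) u *m (frame (lx c) u)^T \in unitmx.
Proof. by move=> ac [q cq <-]; rewrite metric_gram// metric_unit. Qed.

Local Notation inverse_gram c q := (invmx (fr c q *m (fr c q)^T)).

Lemma metric_invE c q : atlas c -> chart_dom c q ->
  metric_inv g c q = inverse_gram c q.
Proof. by move=> ac cq; rewrite metric_gram. Qed.

Lemma pd_metric c i j l q : atlas c -> chart_dom c q ->
  pd c i (fun p => g c p j l : R^o) q =
  dot (partial i (partial j (lx c)) (c q)) (partial l (lx c) (c q)) +
  dot (partial j (lx c) (c q)) (partial i (partial l (lx c)) (c q)).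
Proof.
move=> ac cq; have Uq := chart_cod_map cq; have sxc := sx ac.
have [_ <-] := is_derive_dot (is_derive_partial i (smooth_partial j sxc) Uq)
  (is_derive_partial i (smooth_partial l sxc) Uq).
apply: (eq_partial i (@chart_cod_open _ _ _ c) Uq) => u cu /=.
rewrite -metric_gram//; last exact: chart_inv_dom.
by rewrite chart_invK// gram_entry !rowK.
Qed.

(* The isometry condition g_ij = <x_i, x_j> turns the Koszul formula into
   Gamma_ij,l = <x_ij, x_l>. *)
Lemma christoffelE c k i j q : atlas c -> chart_dom c q ->
  christoffel g c k i j q =
  (partial i (partial j (lx c)) (c q) *m (fr c q)^T *m inverse_gram c q) 0 k.
Proof.
move=> ac cq; have Uq := chart_cod_map cq; have sxc := sx ac.
have oc := @chart_cod_open _ _ _ c.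
have C a b := partialC oc a b Uq sxc.
have -> : inverse_gram c q = (inverse_gram c q)^T.
  by rewrite trmx_inv trmx_mul trmxK.
rewrite /christoffel metric_invE// mulr_sumr [RHS]mxE; apply: eq_bigr => l _.
rewrite mul_tr_entry rowK [(_^T) l k]mxE.
rewrite (pd_metric i j l ac cq) (pd_metric j i l ac cq) (pd_metric l i j ac cq).
(* Of the six inner products in the Koszul formula four cancel by symmetry of second derivatives,
   and the other two coincide. *)
have key (s a b d a' b' d' : R) : a' = a -> b' = b -> d' = d ->
    2^-1 * (s * (a + b + (a' + d) - (b' + d'))) = a * s.
  by move=> -> -> ->; field.
apply: key; first by rewrite (C j i).
  by rewrite dotC (C i l).
by rewrite (C l j).
Qed.

(** Stated for arbitrary F, as it serves both for x and for its Laplacian. *)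
Lemma hessianE (F : M -> 'rV[R]_m) c i j q : atlas c -> chart_dom c q ->
  hessian g c F i j q =
  partial i (partial j (F \o chart_inv c)) (c q) -
  partial i (partial j (lx c)) (c q) *m (fr c q)^T *m inverse_gram c q *m
    frame (F \o chart_inv c) (c q).
Proof.
move=> ac cq; rewrite /hessian pd_pd//; congr (_ - _).
rewrite -sum_partial; apply: eq_bigr => k _.
by congr (_ *: _); exact: christoffelE.
Qed.

(** For F = x the Christoffel term is the tangent part of x_ij, so the Hessian of x is the normal
    part of x_ij. *)
Lemma laplacianE p : laplacian g x p = local_laplacian (lx (chart_at p)) (chart_at p p).
Proof.
have ap := chart_at_atlas p; have dp := chart_at_dom p.
rewrite /laplacian /local_laplacian; congr (- _).
apply: eq_bigr => i _; apply: eq_bigr => j _.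
rewrite metric_invE// hessianE//; congr (_ *: _).
by rewrite /normal_mx mulmxBr mulmx1 !mulmxA.
Qed.

(** Replaces the pointwise choice of chart in [laplacian] by one fixed chart, so that the Laplace
    map can be differentiated there. *)
Lemma laplace_map_chart c u : atlas c -> chart_cod c u ->
  (laplace_map g x \o chart_inv c) u = local_laplacian (lx c) u.
Proof.
move=> ac [q cq <-]; rewrite /= chart_mapK// /laplace_map laplacianE.
exact/esym/local_laplacian_overlap.
Qed.

Lemma normal_partE p v :
  normal_part g x p v = v *m normal_mx (fr (chart_at p) p).
Proof.
have ap := chart_at_atlas p; have dp := chart_at_dom p.
rewrite /normal_part /normal_mx mulmxBr mulmx1; congr (_ - _).
set A := frame _ _.
rewrite !mulmxA -sum_partial /tangent_part exchange_big/=; apply: eq_bigr => j _.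
rewrite -scaler_suml; congr (_ *: _).
rewrite mxE; apply: eq_bigr => i _; rewrite metric_invE// mulrC; congr (_ * _).
by rewrite mul_tr_entry rowK.
Qed.

(** Beltrami's formula, solved for H. *)
Lemma mean_curvatureE p :
  mean_curvature g x p = - n%:R^-1 *: laplace_map g x p.
Proof.
have ap := chart_at_atlas p; have dp := chart_at_dom p.
rewrite /laplace_map laplacianE /mean_curvature /local_laplacian scalerN scaleNr opprK.
congr (_ *: _); apply: eq_bigr => i _; apply: eq_bigr => j _.
by rewrite metric_invE// /second_form normal_partE pd_pd.
Qed.

Lemma frame_laplace_map c q : atlas c -> chart_dom c q ->
  frame (laplace_map g x \o chart_inv c) (c q) = frame (local_laplacian (lx c)) (c q).
Proof.
move=> ac cq; apply/row_matrixP => i; rewrite [LHS]row_frame [RHS]row_frame.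
apply: (eq_partial i (@chart_cod_open _ _ _ c) (chart_cod_map cq)) => u cu.
exact: laplace_map_chart.
Qed.

Lemma laplace_map_tangent p : (0 < n)%N -> parallel_mean_curvature g x ->
  frame (local_laplacian (lx (chart_at p))) (chart_at p p) *m
    normal_mx (fr (chart_at p) p) = 0.
Proof.
move=> n0 par; have ap := chart_at_atlas p; have dp := chart_at_dom p.
set c := chart_at p; have sL := smooth_local_laplacian (@chart_cod_open _ _ _ c)
  (sx ap) (fun u => @gram_unit_chart _ _ ap).
apply/row_matrixP => i; rewrite row0 row_mul rowK.
have := par p (delta_mx 0 i); rewrite /normal_connection normal_partE differentialE.
rewrite -rowE rowK -/c.
have -> : partial i (mean_curvature g x \o chart_inv c) (c p) =
    - n%:R^-1 *: partial i (local_laplacian (lx c)) (c p).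
  rewrite -deriveZ; last first.
    by have [] := smooth_entries_derive i (chart_cod_map dp) sL.
  apply: (eq_partial i (@chart_cod_open _ _ _ c) (chart_cod_map dp)) => u cu.
  rewrite /= mean_curvatureE; congr (_ *: _).
  exact: laplace_map_chart.
(* As n > 0, the factor - 1/n is nonzero and can be removed. *)
rewrite -scalemxAl => /eqP; rewrite scaler_eq0 oppr_eq0 invr_eq0 pnatr_eq0.
by rewrite eqn0Ngt n0 => /eqP.
Qed.

End IsometricImmersion.

Theorem theorem1p4 (R : realType) (n m : nat) (M : manifold R n)
  (g : riemannian_metric M) (x : M -> 'rV[R]_m)
  (n_gt0 : (0 < n)%N)
  (M_connected : connected [set: M]%classic)
  (x_isometric : isometric_immersion g x)
  (H_parallel : parallel_mean_curvature g x) :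
  harmonic_onto_image g (laplace_map g x).
Proof.
move=> p Y; have ap := chart_at_atlas p; have dp := chart_at_dom p.
have gu u := @gram_unit_chart _ _ _ _ _ _ x_isometric (chart_at p) u ap.
have sx : smooth_on (chart_cod (chart_at p)) (x \o chart_inv (chart_at p)).
  by case: x_isometric => s _ _; exact: s.
have tan := laplace_map_tangent x_isometric p n_gt0 H_parallel.
have harm := local_harmonic (@chart_cod_open _ _ _ _) sx gu (chart_cod_map dp) tan.
(* The tension field is the contracted Hessian in [harm], once the Laplace map is replaced by its
   local formula on the whole chart image. *)
have T : tension g (laplace_map g x) p *m
    (frame (x \o chart_inv (chart_at p)) (chart_at p p))^T = 0.
  apply: etrans harm; congr (_ *m _).
  rewrite /tension /laplacian opprK; apply: eq_bigr => i _; apply: eq_bigr => j _.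
  apply: (congr2 (fun a (b : 'rV[R]_m) => a *: b)).
    by rewrite (metric_invE x_isometric ap dp).
  apply: etrans (hessianE x_isometric (laplace_map g x) i j ap dp) _.
  apply: (congr2 (fun a b : 'rV[R]_m => a - b)); last first.
    by rewrite (frame_laplace_map x_isometric ap dp).
  have oc := @chart_cod_open _ _ _ (chart_at p).
  apply: (eq_partial i oc (chart_cod_map dp)) => u cu.
  apply: (eq_partial j oc cu) => v cv.
  exact: (laplace_map_chart x_isometric ap cv).
(* By tangency dL(Y) is a combination of the rows of the frame of x, to which the tension field is
   orthogonal by [T]. *)
move/eqP: tan; rewrite mulmxBr mulmx1 subr_eq0 => /eqP tan.
rewrite dotE differentialE (frame_laplace_map x_isometric ap dp) tan.
by rewrite !mulmxA trmx_mul mulmxA T mul0mx mxE.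
Qed.
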